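(* Let value profiles be drawn from the product prior $\mathsf F=F^{\otimes n}$ on $[\underline v,\bar v]^n$, where $F$ is atomless, strictly increasing and continuously differentiable, with positive density $f>0$ on the interior of the support. Consider the PBS game with $q_1\in(0,1)$ in which all builders are slow. If the one-shot first-price auction with marginal distribution $F$ has a unique symmetric pure equilibrium bid function $\beta^{\mathrm{FPA}}$, then every regular pure all-slow PBS perfect Bayesian equilibrium, with complete plan $(x,z)$, is diagonal: $$x(v)=z(v)=\beta^{\mathrm{FPA}}(v)\quad\text{for }F\text{-almost every }v.$$ Consequently, every such PBE is payoff-equivalent to the standard first-price auction.
   Context: PBS game with parameter $q_1$, all builders slow. There are $n$ builders. Values $v=(v_1,\dots,v_n)\in\mathbb R_+^n$ are drawn from a commonly known prior; $B_i$ privately observes $v_i$ and submits a stage-1 bid $b_{i,1}\in\mathbb R_+$. With exogenous probability $q_1$ the auction terminates at stage 1; otherwise it terminates at stage 2 (and the stage-1 bids are broadcast). A slow builder receives no information update before stage 2: its stage-2 information is only its own value and own stage-1 bid. Each $B_i$ submits a stage-2 bid $b_{i,2}\ge b_{i,1}$. At the terminal stage $t$ the highest stage-$t$ bidder wins (symmetric tie-breaking), pays its own stage-$t$ bid, and gets $v_i-b_{i,t}$; others get $0$. A perfect Bayesian equilibrium (PBE) requires builders to be sequentially rational at every information set given beliefs, with beliefs following Bayes' rule on path. (The proposer is passive.) Regular pure class. A symmetric pure assessment of the all-slow PBS game is regular pure if there exist functions $(x,z):[\underline v,\bar v]\to\mathbb R_+^2$ such that every builder uses the complete plan $b_{i,1}=x(v_i)$,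 $b_{i,2}=z(v_i)$, and: (i) $0\le x(v)\le z(v)\le v$ for every $v$; (ii) $x$ and $z$ are continuous, nondecreasing, and locally absolutely continuous; (iii) if $H_x$ and $H_z$ denote the bid distribution functions induced by $x(V)$ and $z(V)$ for $V\sim F$, then their interior supports have no atoms or gaps and $H_x(x(v))=H_z(z(v))=F(v)$ at interior values $v$; and finally the complete plan $(x(v),z(v))$ is a full-plan best response for each value $v$ (i.e. among all feasible pairs of stage-1 and stage-2 bids, given that the others use $(x,z)$). *)

(* Defs.v *)
From HB Require Import structures.
From mathcomp Require Import all_boot all_order all_algebra.
From mathcomp Require Import all_classical all_reals all_analysis.

Set Implicit Arguments.
Unset Strict Implicit.
Unset Printing Implicit Defensive.

Import Order.TTheory GRing.Theory Num.Theory.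
Import numFieldNormedType.Exports.

Local Open Scope classical_set_scope.
Local Open Scope ring_scope.

Section Prior.
Context {R : realType}.
Implicit Types (mu : probability R R) (F : R -> R).
Implicit Types (vl vh : R).

Record marginal_prior mu F vl vh : Prop := MarginalPrior {
  prior_bounds : 0 <= vl < vh ;
  prior_support : mu [set` `[vl, vh]] = 1%E ;
  prior_cdf : forall v, mu [set` `]-oo, v]] = (F v)%:E ;
  prior_atomless : forall v, mu [set v] = 0%E ;
  prior_increasing : {in `[vl, vh] &, {homo F : v w / v < w}} ;
  prior_derivable : {in `]vl, vh[, forall v, derivable F v 1} ;
  prior_C1 : {in `]vl, vh[, continuous (derive1 F)} ;
  prior_density_gt0 : {in `]vl, vh[, forall v, 0 < derive1 F v} }.

(* The product rule on measurable boxes determines [P] uniquely, so this says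
   that [P] is the n-fold product of [mu]. *)
Definition product_prior n mu
    (P : probability (n.-tuple R) R) :=
  forall A : 'I_n -> set R, (forall i, measurable (A i)) ->
    P [set w | forall i, A i (tnth w i)] = (\prod_(i < n) mu (A i))%E.

Definition value_profiles n vl vh : set (n.-tuple R) :=
  [set w | forall i, tnth w i \in `[vl, vh]].

End Prior.

Section PayYourBidAuction.
Context {R : realType} {n : nat}.
Implicit Types (b : 'I_n -> R) (i : 'I_n) (v : R).

Definition highest_bidders b : {set 'I_n} := [set i | [forall j, b j <= b i]].

Definition win_prob b i : R :=
  if i \in highest_bidders b then #|highest_bidders b|%:R^-1 else 0.

Definition auction_payoff v b i : R := win_prob b i * (v - b i).

Definition override b i (bi : R) : 'I_n -> R :=
  fun j => if j == i then bi else b j.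

Definition bids (s : 'I_n -> R -> R)
  (w : n.-tuple R) : 'I_n -> R := fun j => s j (tnth w j).

End PayYourBidAuction.

Section FirstPriceAuction.
Context {R : realType} {n : nat}.
Variables (mu : probability R R)
  (P : probability (n.-tuple R) R) (vl vh : R).
Implicit Types (beta : R -> R) (i : 'I_n) (v b : R).

(* Expected payoff of [i] given its value [v], when it bids [b] and the others
   follow [beta].  As [P] is a product, the law of the other values given
   [V_i = v] is their unconditional law; coordinate [i] of the profile [w] is
   not used by the integrand. *)
Definition fpa_interim beta i v b : R :=
  \int[P]_(w in value_profiles vl vh)
    auction_payoff v (override (bids (fun=> beta) w) i b) i.

Definition fpa_exante beta i : R :=
  \int[P]_(w in value_profiles vl vh)
    auction_payoff (tnth w i) (bids (fun=> beta) w) i.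

Definition fpa_equilibrium beta :=
  [/\ measurable_fun [set` `[vl, vh]] beta,
      {in `[vl, vh], forall v, 0 <= beta v} &
      forall i, {in `[vl, vh], forall v b, 0 <= b ->
        fpa_interim beta i v b <= fpa_interim beta i v (beta v)}].

(* Uniqueness is up to null sets of values.  Pointwise uniqueness would be
   unsatisfiable when [0 < vl] and [2 <= n]: type [vl] wins with probability 0
   and is indifferent between all bids in [0, vl]. *)
Definition unique_fpa_equilibrium beta :=
  fpa_equilibrium beta /\
  forall beta', fpa_equilibrium beta' ->
    {ae mu, forall v, v \in `[vl, vh] -> beta' v = beta v}.

End FirstPriceAuction.

Section SlowPBSGame.
Context {R : realType} {n : nat}.

(* The list of all builders' private stage-2 information: values paired with
   own stage-1 bids. *)
Definition history := n.-tuple (R * R)%type.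

(* A slow builder sees no update before stage 2, so its stage-2 bid and belief
   depend only on its own value and own stage-1 bid. *)
Record assessment := Assessment {
  stage1 : 'I_n -> R -> R ;
  stage2 : 'I_n -> R -> R -> R ;
  belief : 'I_n -> R -> R -> probability history R }.

Variables (mu : probability R R)
  (P : probability (n.-tuple R) R) (vl vh q1 : R).
Implicit Types (a : assessment) (i : 'I_n) (v : R) (x z : R -> R).

Definition onpath2 a i v : R := stage2 a i v (stage1 a i v).

Definition pbs_payoff v (b1 b2 : 'I_n -> R) i : R :=
  q1 * auction_payoff v b1 i + (1 - q1) * auction_payoff v b2 i.

(* Expected payoff of [i] given its value [v], when it uses the complete plan
   [(b1, b2)] and the others the complete plans [(s1 j, s2 j)]; see
   [fpa_interim] for the conditioning. *)
Definition plan_payoff (s1 s2 : 'I_n -> R -> R) i v (b1 b2 : R) : R :=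
  \int[P]_(w in value_profiles vl vh)
    pbs_payoff v (override (bids s1 w) i b1) (override (bids s2 w) i b2) i.

Definition plan_best_response (s1 s2 : 'I_n -> R -> R) i v (b1 b2 : R) :=
  forall b1' b2', 0 <= b1' -> b1' <= b2' ->
    plan_payoff s1 s2 i v b1' b2' <= plan_payoff s1 s2 i v b1 b2.

Definition pbs_interim a i v : R :=
  plan_payoff (stage1 a) (onpath2 a) i v (stage1 a i v) (onpath2 a i v).

Definition pbs_exante a i : R :=
  \int[P]_(w in value_profiles vl vh)
    pbs_payoff (tnth w i) (bids (stage1 a) w) (bids (onpath2 a) w) i.

Definition feasible a := forall i,
  [/\ measurable_fun [set` `[vl, vh]] (stage1 a i),
      measurable_fun
        [set p : R * R |
           p.1 \in `[vl, vh] /\ 0 <= p.2]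
        (fun p => stage2 a i p.1 p.2),
      {in `[vl, vh], forall v, 0 <= stage1 a i v} &
      {in `[vl, vh], forall v b1, 0 <= b1 -> b1 <= stage2 a i v b1}].

Definition information_set i v (b1 : R) : set history :=
  [set h | tnth h i = (v, b1) /\
    forall j, (tnth h j).1 \in `[vl, vh] /\ 0 <= (tnth h j).2].

Definition stage2_payoff a i v (b1 b2 : R) : R :=
  \int[belief a i v b1]_(h in information_set i v b1)
    auction_payoff v
      (override (fun j => stage2 a j (tnth h j).1 (tnth h j).2) i b2) i.

(* From the stage-1 information set [v] on, a pure continuation strategy
   amounts to a feasible pair [(b1, b2)]. *)
Definition sequentially_rational a := forall i,
  {in `[vl, vh], forall v,
     plan_best_response (stage1 a) (onpath2 a) i v
       (stage1 a i v) (onpath2 a i v)} /\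
  {in `[vl, vh], forall v b1 b2, 0 <= b1 -> b1 <= b2 ->
     stage2_payoff a i v b1 b2 <= stage2_payoff a i v b1 (stage2 a i v b1)}.

Definition belief_system a := forall i, {in `[vl, vh], forall v b1, 0 <= b1 ->
  belief a i v b1 (information_set i v b1) = 1%E}.

Definition path_history a (w : n.-tuple R) : history :=
  [tuple (tnth w j, stage1 a j (tnth w j)) | j < n].

(* On path, the beliefs of [i] are a regular conditional distribution of the
   history given the information of [i].  That information is generated by the
   value of [i] alone, its stage-1 bid being a function of it; termination is
   exogenous, hence reaching stage 2 is uninformative. *)
Definition bayes_on_path a := forall i (B : set history), measurable B ->
  measurable_fun [set` `[vl, vh]]
    (fun v => fine (belief a i v (stage1 a i v) B)) /\
  forall A : set R, measurable A -> A `<=` [set` `[vl, vh]] ->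
    P [set w | [/\ value_profiles vl vh w, A (tnth w i) & B (path_history a w)]]
    = (\int[mu]_(v in A) belief a i v (stage1 a i v) B)%E.

Definition perfect_bayesian_equilibrium a :=
  [/\ feasible a, belief_system a, sequentially_rational a & bayes_on_path a].

Definition absolutely_continuous_on (g : R -> R) (c d : R) :=
  forall e : R, 0 < e -> exists2 dl : R, 0 < dl &
    forall m (l r : 'I_m -> R),
      (forall k, c <= l k /\ l k <= r k /\ r k <= d) ->
      (forall j k, j != k -> r j <= l k \/ r k <= l j) ->
      \sum_(k < m) (r k - l k) < dl ->
      \sum_(k < m) `|g (r k) - g (l k)| < e.

(* Absolute continuity on the compact subintervals of the interior. *)
Definition locally_absolutely_continuous (g : R -> R) :=
  forall c d, vl < c -> c <= d -> d < vh -> absolutely_continuous_on g c d.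

Definition bid_law (g : R -> R) (B : set R) : \bar R :=
  mu ([set` `[vl, vh]] `&` g @^-1` B).

Definition bid_support (g : R -> R) : set R :=
  [set b | forall e : R, 0 < e -> (0 < bid_law g (ball b e))%E].

Definition regular_bid_law (F g : R -> R) :=
  [/\ forall b, (bid_support g)^° b -> bid_law g [set b] = 0%E,
      is_interval (bid_support g)^° &
      {in `]vl, vh[, forall v, bid_law g [set` `]-oo, g v]] = (F v)%:E}].

Definition symmetric_strategies a := forall i j, {in `[vl, vh], forall v,
  stage1 a i v = stage1 a j v /\
  forall b1, 0 <= b1 -> stage2 a i v b1 = stage2 a j v b1}.

Record regular_pure (F : R -> R) a x z : Prop := RegularPure {
  regular_symmetric : symmetric_strategies a ;
  regular_plan : forall i, {in `[vl, vh], forall v,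
    stage1 a i v = x v /\ stage2 a i v (x v) = z v} ;
  regular_order : {in `[vl, vh], forall v, [/\ 0 <= x v, x v <= z v & z v <= v]} ;
  regular_continuous : {within `[vl, vh], continuous x} /\
                       {within `[vl, vh], continuous z} ;
  regular_nondecreasing : {in `[vl, vh] &, {homo x : v w / v <= w}} /\
                          {in `[vl, vh] &, {homo z : v w / v <= w}} ;
  regular_ac : locally_absolutely_continuous x /\
               locally_absolutely_continuous z ;
  regular_laws : regular_bid_law F x /\ regular_bid_law F z ;
  regular_best_response : forall i, {in `[vl, vh], forall v,
    plan_best_response (fun=> x) (fun=> z) i v (x v) (z v)} }.

Definition payoff_equivalent_to_fpa a (beta : R -> R) := forall i,
  {in `[vl, vh], forall v,
     pbs_interim a i v = fpa_interim P vl vh beta i v (beta v)} /\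
  pbs_exante a i = fpa_exante P vl vh beta i.

End SlowPBSGame.
Arguments assessment : clear implicits.
Arguments history : clear implicits.

(* Main.v *)
Require Import Defs.
From HB Require Import structures.
From mathcomp Require Import all_boot all_order all_algebra.
From mathcomp Require Import all_classical all_reals all_analysis.
From mathcomp Require Import measurable_realfun lra.

(** With strictly increasing bid functions, bidding [x w] wins stage 1 with
    probability [G w = F w ^ (n - 1)], and likewise for [z] in stage 2, so type
    [v] may imitate the stage-1 bid of [w] and the stage-2 bid of [w'] whenever
    [x w <= z w'].  Near a type with [x < z] the constraint does not bind and
    both stages satisfy the incentive constraints of the first-price auction
    separately, so [G * (z - x)] is locally constant where it is positive.  It
    is continuous and vanishes at the lowest type, hence it vanishes everywhere.
    Once [x = z], deviations to equal bids in both stages show that [x] is an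
    equilibrium of the first-price auction. *)

Set Implicit Arguments.
Unset Strict Implicit.
Unset Printing Implicit Defensive.

Import Order.TTheory GRing.Theory Num.Theory.
Import numFieldNormedType.Exports.

Local Open Scope classical_set_scope.
Local Open Scope ring_scope.

(** * Winning probabilities at a fixed bid profile, and their measurability *)

Section WinProbability.
Context {R : realType} {n : nat}.
Implicit Types (b : 'I_n -> R) (i : 'I_n).

Lemma highest_biddersP b i :
  reflect (forall j, b j <= b i) (i \in highest_bidders b).
Proof. by rewrite inE; exact: forallP. Qed.

Lemma win_prob_ge0 b i : 0 <= win_prob b i.
Proof. by rewrite /win_prob; case: ifP => // _; rewrite invr_ge0. Qed.

Lemma win_prob_le1 b i : win_prob b i <= 1.
Proof.
rewrite /win_prob; case: ifPn => // hi.
rewrite invf_le1 ?ler1n ?ltr0n; last by apply/card_gt0P; exists i.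
by apply/card_gt0P; exists i.
Qed.

Lemma win_prob_winner b i : (forall j, j != i -> b j < b i) -> win_prob b i = 1.
Proof.
move=> lt_bi; have hi : i \in highest_bidders b.
  by apply/highest_biddersP => j; have [->//|/lt_bi/ltW] := eqVneq j i.
rewrite /win_prob hi (_ : highest_bidders b = [set i]%SET) ?cards1 ?invr1//.
apply/setP => j; rewrite finset.in_set1; have [->//|ji] := eqVneq j i.
by apply/negbTE/negP => /highest_biddersP/(_ i); rewrite leNgt lt_bi.
Qed.

Lemma win_prob_loser b i j : b i < b j -> win_prob b i = 0.
Proof.
move=> ij; rewrite /win_prob ifF//.
by apply/negbTE/negP => /highest_biddersP/(_ j); rewrite leNgt ij.
Qed.

(** The product tests whether [i] is a highest bidder; if so, the sum counts the highest bidders. In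
    this form measurability follows from that of comparisons, and the inverse is a real power
    because [powR] is measurable in its base. *)
Lemma win_probE b i : win_prob b i =
  (\prod_(j < n) (b j <= b i)%R%:R) * (\sum_(j < n) (b i <= b j)%R%:R) `^ (-1).
Proof.
rewrite powR_inv1 ?sumr_ge0// /win_prob; case: ifPn => hi; last first.
  move: hi; rewrite inE negb_forall => /existsP[j /negbTE bji].
  by rewrite (bigD1 j)//= bji !mul0r.
move/highest_biddersP : (hi) => bi.
rewrite big1 ?mul1r => [|j _]; last by rewrite bi.
congr (_^-1); rewrite -sum1_card natr_sum big_mkcond; apply: eq_bigr => j _.
case: ifPn => [/highest_biddersP ->//|/negP jn].
case: (leP (b i) (b j)) => // bij; case: jn.
by apply/highest_biddersP => k; exact: le_trans (bi k) bij.
Qed.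

End WinProbability.

Lemma measurable_win_prob {R : realType} {n : nat} d (T : measurableType d)
    (D : set T) (b : T -> 'I_n -> R) (i : 'I_n) :
  (forall j, measurable_fun D (fun w => b w j)) ->
  measurable_fun D (fun w => win_prob (b w) i).
Proof.
move=> mb; under eq_fun do rewrite win_probE.
have mle j k : measurable_fun D (fun w => (b w j <= b w k)%R%:R : R).
  apply: (measurableT_comp (f := fun c : bool => c%:R : R)) => //.
  exact: measurable_fun_ler.
apply: measurable_funM; first exact: measurable_prod.
apply: (measurableT_comp (measurable_powR _)).
exact: measurable_sum.
Qed.

Lemma measurable_auction_payoff {R : realType} {n : nat} d
    (T : measurableType d) (D : set T) (u : T -> R) (b : T -> 'I_n -> R) i :
  measurable_fun D u -> (forall j, measurable_fun D (fun w => b w j)) ->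
  measurable_fun D (fun w => auction_payoff (u w) (b w) i).
Proof.
move=> mu mb; apply: measurable_funM; first exact: measurable_win_prob.
exact: measurable_funB.
Qed.

(** * Null sets in integrals and probabilities *)

Lemma ae_eq_Rintegral {R : realType} d (T : measurableType d)
    (P : {measure set T -> \bar R}) (D : set T) (f g : T -> R) :
  measurable D -> measurable_fun D f -> measurable_fun D g ->
  ae_eq P D f g -> \int[P]_(w in D) f w = \int[P]_(w in D) g w.
Proof.
move=> mD mf mg fg; rewrite /Rintegral; congr fine.
apply: ae_eq_integral => //; try exact/measurable_EFinP.
exact: ae_eq_comp fg.
Qed.

Lemma probability_setI1 {R : realType} d (T : measurableType d)
    (P : probability T R) (A B : set T) :
  measurable A -> measurable B -> P B = 1%E -> P (A `&` B) = P A.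
Proof.
move=> mA mB PB1; have -> : P A = (P (A `\` B) + P (A `&` B))%E by exact: measureDI.
suff -> : P (A `\` B) = 0%E by rewrite add0e.
apply/eqP; rewrite -measure_le0.
have <- : P (~` B) = 0%E by rewrite probability_setC// PB1 subee.
apply: le_measure; rewrite ?inE; [exact: measurableD|exact: measurableC|].
by move=> t [].
Qed.

(** * The distribution function and the product prior *)

Section PriorFacts.
Context {R : realType} {n : nat} (mu : probability R R) (F : R -> R).
Context (vl vh : R) (prior_mu : marginal_prior mu F vl vh).
Context (P : probability (n.-tuple R) R) (prior_P : product_prior mu P).

Lemma vl_lt_vh : vl < vh.
Proof. by case: prior_mu => /andP[]. Qed.

Lemma prior_itv v : v \in `[vl, vh] -> mu [set` `[vl, v]] = (F v)%:E.
Proof.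
rewrite in_itv/= => /andP[lv vh']; rewrite -(prior_cdf prior_mu).
rewrite -[RHS](probability_setI1 (B := [set` `[vl, vh]]) _ _ (prior_support prior_mu))//.
congr (mu _); apply/seteqP; split => u /=; rewrite !in_itv/=.
  by move=> /andP[-> uv]; rewrite uv (le_trans uv vh').
by move=> [-> /andP[->]].
Qed.

Lemma cdf_vl : F vl = 0.
Proof.
apply: EFin_inj; rewrite -prior_itv ?in_itv/= ?lexx ?(ltW vl_lt_vh)//.
by rewrite set_itv1 (prior_atomless prior_mu).
Qed.

Lemma cdf_gt0 v : v \in `]vl, vh[ -> 0 < F v.
Proof.
rewrite in_itv/= => /andP[lv vh']; rewrite -cdf_vl.
by apply: (prior_increasing prior_mu); rewrite // in_itv/= ?lexx ?ltW ?vl_lt_vh.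
Qed.

(** Derivability gives continuity at interior points; at [vl] it comes from right-continuity of
    distribution functions. *)
Lemma cdf_continuous v : v \in `]vl, vh[ -> {within `[vl, v], continuous F}.
Proof.
rewrite in_itv/= => /andP[vlv vvh].
have cF u : u \in `]vl, vh[ -> F x @[x --> u] --> F u.
  move=> uI; apply: differentiable_continuous.
  exact/derivable1_diffP/(prior_derivable prior_mu).
apply/(continuous_within_itvP _ vlv); split => [u||].
- rewrite in_itv/= => /andP[lu uv]; apply: cF; rewrite in_itv/= lu/=.
  exact: lt_trans uv vvh.
(* [F] is the distribution function of the identity, seen as a random variable under [mu]. *)
- have mid : (idfun : R -> R) \in mfun by rewrite inE; exact: measurable_id.
  have FE x : F x = fine (cdf (mfun_Sub mid : {RV mu >-> R}) x).
    by rewrite /cdf /distribution /pushforward/= (prior_cdf prior_mu).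
  rewrite (_ : F = fine \o cdf (mfun_Sub mid : {RV mu >-> R})); last first.
    exact/funext.
  apply: fine_cvg; rewrite fineK ?fin_num_measure//.
  exact: cdf_right_continuous.
- by apply: cvg_at_left_filter; apply: cF; rewrite in_itv/= vlv.
Qed.

Lemma product_prior_coordinate j (A : set R) : measurable A ->
  P [set w | A (tnth w j)] = mu A.
Proof.
move=> mA; pose B k := if k == j then A else setT.
have -> : [set w : n.-tuple R | A (tnth w j)] =
    [set w | forall k, B k (tnth w k)].
  apply/seteqP; split => w /=; last by move/(_ j); rewrite /B eqxx.
  by move=> Aw k; rewrite /B; case: eqP => // ->.
rewrite prior_P => [|k]; last by rewrite /B; case: ifP.
rewrite (bigD1 j)//= {1}/B eqxx big1 ?mule1// => k /negbTE kj.
by rewrite /B kj probability_setT.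
Qed.

Lemma measurable_coordinates (A : 'I_n -> set R) :
  (forall j, measurable (A j)) ->
  measurable [set w : n.-tuple R | forall j, A j (tnth w j)].
Proof.
move=> mA; rewrite (_ : [set _ | _] =
    \bigcap_(j in [set: 'I_n]) ((fun w => tnth w j) @^-1` A j)); last first.
  by apply/seteqP; split => w /= Aw j *; exact: Aw.
apply: fin_bigcap_measurable => [|j _]; first exact: finite_finset.
by rewrite -[X in measurable X]setTI; exact: measurable_tnth.
Qed.

Lemma measurable_value_profiles :
  measurable (@value_profiles R n vl vh).
Proof.
exact: (measurable_coordinates (A := fun=> [set` `[vl, vh]])).
Qed.

Lemma measurable_bid (g : R -> R) j :
  measurable_fun [set` `[vl, vh]] g ->
  measurable_fun (@value_profiles R n vl vh) (fun w => g (tnth w j)).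
Proof.
move=> mg; apply: (measurable_comp (F := [set` `[vl, vh]])) => //.
- by move=> _ [w + <-]; exact.
- exact: measurable_funS (measurable_tnth j).
Qed.

Lemma measurable_override_bids (g : R -> R) i c j :
  measurable_fun [set` `[vl, vh]] g ->
  measurable_fun (@value_profiles R n vl vh)
    (fun w => override (bids (fun=> g) w) i c j).
Proof.
move=> mg; rewrite /override/=; case: (j == i); first exact: measurable_cst.
exact: measurable_bid.
Qed.

(** Each coordinate has law [mu], and finitely many null sets are discarded. *)
Lemma ae_coordinates (Q : R -> Prop) :
  {ae mu, forall v, Q v} -> {ae P, forall w, forall j, Q (tnth w j)}.
Proof.
move=> [N [mN N0 QN]]; apply: filter_forall => j.
exists [set w | N (tnth w j)]; split => [||w Qj]; last exact: QN.
  by rewrite -[X in measurable X]setTI; exact: measurable_tnth.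
by rewrite product_prior_coordinate.
Qed.

End PriorFacts.

(** * Interim chances of winning against a common bid function *)

Section WinChance.
Context {R : realType} {n : nat} (mu : probability R R) (F : R -> R).
Context (vl vh : R) (prior_mu : marginal_prior mu F vl vh).
Context (P : probability (n.-tuple R) R) (prior_P : product_prior mu P).
Implicit Types (g x z : R -> R) (i j : 'I_n).

Let D : set (n.-tuple R) := @value_profiles R n vl vh.

Definition win_chance g i b : R :=
  \int[P]_(w in D) win_prob (override (bids (fun=> g) w) i b) i.

Lemma integrable_win_prob g i b : measurable_fun [set` `[vl, vh]] g ->
  P.-integrable D
    (EFin \o (fun w => win_prob (override (bids (fun=> g) w) i b) i)).
Proof.
move=> mg; apply: measurable_bounded_integrable.
- exact: measurable_value_profiles.
- exact: le_lt_trans (probability_le1 _ (measurable_value_profiles _ _)) (ltry _).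
- by apply: measurable_win_prob => j; exact: measurable_override_bids.
- exists 1; split=> // M M1 w _ /=.
  by rewrite ger0_norm ?win_prob_ge0// (le_trans (win_prob_le1 _ _))// ltW.
Qed.

(** The own bids are constants under the integral, so each stage contributes its chance of winning
    times a fixed margin. *)
Lemma plan_payoffE x z q i v b1 b2 :
  measurable_fun [set` `[vl, vh]] x -> measurable_fun [set` `[vl, vh]] z ->
  plan_payoff P vl vh q (fun=> x) (fun=> z) i v b1 b2 =
  q * (win_chance x i b1 * (v - b1)) + (1 - q) * (win_chance z i b2 * (v - b2)).
Proof.
move=> mx mz; pose W g b w := win_prob (override (bids (fun=> g) w) i b) i.
have mD : measurable D by exact: measurable_value_profiles.
have iW g b c d : measurable_fun [set` `[vl, vh]] g ->
    P.-integrable D (EFin \o (fun w => c * (W g b w * d))).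
  move=> mg; have := integrable_win_prob i b mg => iw.
  have /(integrableZl mD c) : P.-integrable D (EFin \o (fun w => W g b w * d)).
    exact: (integrableZr mD d iw).
  exact.
rewrite /plan_payoff /pbs_payoff /auction_payoff.
under eq_Rintegral do rewrite /override eqxx -!/(override _ _ _).
rewrite (RintegralD mD (iW x b1 q (v - b1) mx) (iW z b2 (1 - q) (v - b2) mz)).
rewrite !RintegralZl// ?RintegralZr//; try exact: integrable_win_prob.
  exact: (integrableZr mD _ (integrable_win_prob i b2 mz)).
exact: (integrableZr mD _ (integrable_win_prob i b1 mx)).
Qed.

(** Outside the null event that some value equals [w], the bid [g w] wins exactly when all the other
    values are at most [w]; these values are independent. *)
Lemma win_chanceE g i w : measurable_fun [set` `[vl, vh]] g ->
  {in `[vl, vh] &, {homo g : u v / u < v}} -> w \in `[vl, vh] ->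
  win_chance g i (g w) = F w ^+ n.-1.
Proof.
move=> mg g_incr wI.
have mD : measurable D by exact: measurable_value_profiles.
(* Coordinate [i] ranges over the whole support and contributes a factor 1, hence the exponent
   [n.-1]. *)
pose A j := if j == i then [set` `[vl, vh]] else [set` `[vl, w]].
have mA j : measurable (A j) by rewrite /A; case: ifP.
pose E : set (n.-tuple R) := [set p | forall j, A j (tnth p j)].
have mE : measurable E by exact: (measurable_coordinates mA).
have wvh : w <= vh by move: wI; rewrite in_itv/= => /andP[].
have ED : E `<=` D.
  move=> p Ep j; have := Ep j; rewrite /A; case: ifP => // _ /=.
  by rewrite !in_itv/= => /andP[-> /le_trans->].
have no_tie : {ae P, forall p : n.-tuple R, forall j, tnth p j != w}.
  apply: (ae_coordinates prior_P (Q := fun v => v != w)); exists [set w]; split => //.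
    exact: (prior_atomless prior_mu).
  by move=> v /= /negP; rewrite negbK => /eqP.
have PE : P E = (F w ^+ n.-1)%:E.
  rewrite prior_P// (bigD1 i)//= {1}/A eqxx (prior_support prior_mu) mul1e.
  under eq_bigr => j /negbTE ji do rewrite /A ji (prior_itv prior_mu)//.
  by rewrite prodEFin prodr_const cardC1 card_ord.
rewrite /win_chance (@ae_eq_Rintegral _ _ _ _ _ _ (\1_E)) //.
- by rewrite /Rintegral integral_indic// setIidl// -[LHS]/(fine (P E)) PE.
- by apply: measurable_win_prob => j; exact: measurable_override_bids.
apply: filterS no_tie => p no_tie Dp.
have pI j : tnth p j \in `[vl, vh] by exact: Dp.
have bi : override (bids (fun=> g) p) i (g w) i = g w by rewrite /override eqxx.
have bj j : j != i -> override (bids (fun=> g) p) i (g w) j = g (tnth p j).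
  by rewrite /override => /negbTE ->.
have [Ep|nEp] := pselect (E p).
  rewrite indicE mem_set// win_prob_winner// => j ji; rewrite bi bj//.
  apply: g_incr => //; rewrite lt_neqAle no_tie/=.
  by have := Ep j; rewrite /A (negbTE ji)/= in_itv/= => /andP[].
rewrite indicE memNset//; have /existsNP[j] := nEp.
rewrite /A; have [_ /(_ (pI j))//|ji npj] := eqVneq j i.
rewrite (@win_prob_loser _ _ _ _ j)// bi bj//; apply: g_incr => //.
rewrite ltNge; apply/negP => pjw; apply: npj => /=.
by move: (pI j); rewrite !in_itv/= pjw andbT => /andP[].
Qed.

(** On a flat piece of [g] a single bid level would have to carry two different values of [F]. *)
Lemma cdf_law_increasing g : regular_bid_law mu vl vh F g ->
  {in `[vl, vh] &, {homo g : u v / u <= v}} ->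
  {in `[vl, vh] &, {homo g : u v / u < v}}.
Proof.
move=> [_ _ lawg] g_nd u v uI vI uv.
(* The law of [g] is prescribed at interior values only, whereas [u] and [v] may be endpoints;
   strictness is obtained between two interior points. *)
pose s := u + (v - u) / 3; pose t := u + (v - u) * 2 / 3.
have [us st tv] : [/\ u < s, s < t & t < v] by rewrite /s /t; split; lra.
move: (uI) (vI); rewrite !in_itv/= => /andP[lu uh] /andP[lv hv].
have sI : s \in `]vl, vh[ by rewrite in_itv/=; apply/andP; split; lra.
have tI : t \in `]vl, vh[ by rewrite in_itv/=; apply/andP; split; lra.
have [sc tc] := (subset_itv_oo_cc sI, subset_itv_oo_cc tI).
apply: (@le_lt_trans _ _ (g s)); first by apply: g_nd => //; exact: ltW.
apply: (@lt_le_trans _ _ (g t)); last by apply: g_nd => //; exact: ltW.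
rewrite lt_neqAle g_nd ?ltW// andbT; apply/eqP => gst.
have := lawg s sI; rewrite gst (lawg t tI) => -[Fts].
by have := prior_increasing prior_mu sc tc st; rewrite Fts ltxx.
Qed.

Lemma ae_eq_interim g h i v b :
  measurable_fun [set` `[vl, vh]] g -> measurable_fun [set` `[vl, vh]] h ->
  {ae mu, forall v, v \in `[vl, vh] -> g v = h v} ->
  fpa_interim P vl vh g i v b = fpa_interim P vl vh h i v b.
Proof.
move=> mg mh /(ae_coordinates prior_P) gh; apply: ae_eq_Rintegral.
- exact: measurable_value_profiles.
- apply: measurable_auction_payoff => [|j]; first exact: measurable_cst.
  exact: measurable_override_bids.
- apply: measurable_auction_payoff => [|j]; first exact: measurable_cst.
  exact: measurable_override_bids.
apply: filterS gh => p gh Dp; congr auction_payoff.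
by apply/funext => j; rewrite /override /bids gh//; exact: Dp.
Qed.

Lemma ae_eq_exante g h i :
  measurable_fun [set` `[vl, vh]] g -> measurable_fun [set` `[vl, vh]] h ->
  {ae mu, forall v, v \in `[vl, vh] -> g v = h v} ->
  fpa_exante P vl vh g i = fpa_exante P vl vh h i.
Proof.
move=> mg mh /(ae_coordinates prior_P) gh.
have mD : measurable D by exact: measurable_value_profiles.
have mi : measurable_fun D (fun w => tnth w i).
  exact: measurable_funS (measurable_tnth i).
apply: ae_eq_Rintegral => //.
- by apply: measurable_auction_payoff => // j; exact: measurable_bid.
- by apply: measurable_auction_payoff => // j; exact: measurable_bid.
apply: filterS gh => p gh Dp; congr auction_payoff.
by apply/funext => j; rewrite /bids gh//; exact: Dp.
Qed.

End WinChance.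

(** * From incentive constraints to a diagonal plan *)

Lemma within_continuousX {R : realType} (A : set R) (f : R -> R) k :
  {within A, continuous f} -> {within A, continuous (fun t => f t ^+ k)}.
Proof.
move=> cf; elim: k => [|k IH] t.
  by rewrite (_ : (fun _ => _) = cst 1)//; exact: cvg_cst.
rewrite (_ : (fun _ => _) = fun t => f t * f t ^+ k); last first.
  by apply/funext => u; rewrite exprS.
by apply: cvgM; [exact: cf|exact: IH].
Qed.

Section DiagonalPlan.
Context {R : realType}.
Implicit Types (G x z : R -> R) (u v w : R).

(** The difference quotient of [E] at [u] is bounded by the increment of [G], which tends to 0. *)
Lemma is_derive0_of_bound (E G : R -> R) u :
  {for u, continuous G} ->
  (\forall w \near u, `|E w - E u| <= `|w - u| * `|G w - G u|) ->
  is_derive u 1 E 0.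
Proof.
move=> cG EG.
have D0 : h^-1 *: ((E \o shift u) (h *: 1) - E u) @[h --> 0^'] --> (0 : R).
  apply/cvgr0Pnorm_le => e e0.
  have cG' : \forall w \near u, `|G u - G w| <= e by move/cvgrPdist_le : cG; apply.
  have : \forall w \near u, `|E w - E u| <= `|w - u| * e.
    near=> w; apply: (@le_trans _ _ (`|w - u| * `|G w - G u|)); first by near: w.
    by apply: ler_wpM2l => //; rewrite distrC; near: w.
  move=> /nbhs0P Eh; near=> h.
  have h0 : h != 0 by near: h; exact: nbhs_dnbhs_neq.
  rewrite /= normrZ normfV ler_pdivrMl ?normr_gt0//.
  have : `|E (u + h) - E u| <= `|(u + h) - u| * e by near: h; exact: cvg_within.
  by rewrite (addrC u) addrK /GRing.scale/= mulr1.
by split; [apply/cvg_ex; exists 0|exact: cvg_lim].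
Unshelve. all: by end_near. Qed.

(* For [u], [w] close to a point where [x < z], the incentive constraints put the
   increments of both [G * x] and [G * z] between [u * (G w - G u)] and
   [w * (G w - G u)], so [D = G * (z - x)] has derivative 0 wherever it is positive.
   Truncating [D] below at a positive level makes the derivative vanish
   everywhere. *)
Lemma incentive_compatible_diagonal (vl vh q : R) G x z :
  0 < q < 1 -> G vl = 0 -> {in `]vl, vh[, forall v, 0 < G v} ->
  {in `]vl, vh[, forall v, {within `[vl, v], continuous G}} ->
  {within `[vl, vh], continuous x} -> {within `[vl, vh], continuous z} ->
  {in `[vl, vh], forall v, x v <= z v} ->
  {in `[vl, vh] & &, forall v w w', x w <= z w' ->
    q * (G w * (v - x w)) + (1 - q) * (G w' * (v - z w')) <=
    q * (G v * (v - x v)) + (1 - q) * (G v * (v - z v))} ->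
  {in `]vl, vh[, x =1 z}.
Proof.
move=> /andP[q0 q1] Gvl G0 cG cx cz xz IC v vI; apply/eqP; rewrite eq_le.
have sub u : u \in `]vl, vh[ -> u \in `[vl, vh] by exact: subset_itv_oo_cc.
rewrite xz ?sub//= leNgt; apply/negP => xzv.
have [vlv vvh] : vl < v /\ v < vh by move: vI; rewrite in_itv/= => /andP[].
pose D u := G u * (z u - x u).
have Dv : 0 < D v by rewrite mulr_gt0 ?G0// subr_gt0.
(* Any level strictly between 0 and [D v] would serve as the truncation level. *)
pose c := D v / 2.
have [c0 cD] : 0 < c /\ c < D v by rewrite /c; lra.
pose E u := Num.max (D u) c.
have sv : `[vl, v] `<=` `[vl, vh].
  by move=> u /=; rewrite !in_itv/= => /andP[-> /le_trans->//]; exact: ltW.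
have {}cx := continuous_subspaceW sv cx.
have {}cz := continuous_subspaceW sv cz.
have cD' : {within `[vl, v], continuous D}.
  by move=> u; apply: cvgM; [exact: cG | apply: cvgB; [exact: cz | exact: cx]].
have cE : {within `[vl, v], continuous E}.
  move=> u; apply: (@continuous_max _ (subspace `[vl, v])) => //; first exact: cD'.
  exact: cvg_cst.
have at_pt (f : R -> R) u : u \in `]vl, v[ -> {within `[vl, v], continuous f} ->
    {for u, continuous f}.
  by move=> uI /(continuous_within_itvP _ vlv)[+ _ _]; apply.
have dE u : u \in `]vl, v[ -> is_derive u 1 E 0.
  move=> uI.
  have uI' : u \in `]vl, vh[ by apply: subset_itvl uI; rewrite bnd_simp ltW.
  have cGu := at_pt _ _ uI (cG v vI).
  have cDu := at_pt _ _ uI cD'.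
  apply: (is_derive0_of_bound cGu).
  (* Below the level, [E] is constantly [c] near [u]. Otherwise [D u] is positive, which forces
     [x u < z u]. *)
  have [Du|Du] := ltP (D u) c.
    have : \forall w \near u, D w < c by apply: cvgr_lt cDu _ Du.
    apply: filterS => w Dw.
    rewrite /E max_r ?(ltW Dw)// max_r ?(ltW Du)// subrr normr0.
    exact: mulr_ge0.
  have cxu := at_pt _ _ uI cx.
  have czu := at_pt _ _ uI cz.
  have xzu : x u < z u.
    by rewrite -subr_gt0 -(pmulr_rgt0 _ (G0 _ uI')) (lt_le_trans c0).
  (* The midpoint separates the values of [x] from those of [z] near [u], so every mixture of the
     plans of [u] and [w] is feasible. *)
  pose m := (x u + z u) / 2.
  have [xm mz] : x u < m /\ m < z u by rewrite /m; lra.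
  near=> w.
  have xw : x w < m by near: w; apply: cvgr_lt cxu _ xm.
  have zw : m < z w by near: w; apply: cvgr_gt czu _ mz.
  have wI : w \in `]vl, vh[ by near: w; exact: near_in_itvoo.
  have DD : `|D w - D u| <= `|w - u| * `|G w - G u|.
    have [/sub uc /sub wc] := (uI', wI).
    have xwzu : x w <= z u by rewrite ltW ?(lt_trans xw).
    have xuzw : x u <= z w by rewrite ltW ?(lt_trans xm).
    (* In [h1] and [h2], types [u] and [w] copy only each other's stage-1 bid; in [h3] and [h4],
       only the stage-2 bid. The terms of the other stage cancel. *)
    have h1 := IC u w u uc wc uc xwzu; have h2 := IC w u w wc uc wc xuzw.
    have h3 := IC u u w uc uc wc xuzw; have h4 := IC w w u wc wc uc xwzu.
    have {}h1 : G w * (u - x w) <= G u * (u - x u).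
      by rewrite -(ler_pM2l q0); lra.
    have {}h2 : G u * (w - x u) <= G w * (w - x w).
      by rewrite -(ler_pM2l q0); lra.
    have q1' : 0 < 1 - q by lra.
    have {}h3 : G w * (u - z w) <= G u * (u - z u).
      by rewrite -(ler_pM2l q1'); lra.
    have {}h4 : G u * (w - z u) <= G w * (w - z w).
      by rewrite -(ler_pM2l q1'); lra.
    rewrite -normrM; apply: (@le_trans _ _ ((w - u) * (G w - G u))); last first.
      exact: ler_norm.
    by rewrite ler_norml /D; apply/andP; split; lra.
  (* Taking the maximum with a constant does not increase distances. *)
  apply: le_trans DD; rewrite /E.
  have := ler_norm (D w - D u); have := ler_norm (D u - D w).
  rewrite (distrC (D u)) ler_norml => Duw Dwu.
  by case: (leP (D w) c) => Dw; case: (leP (D u) c) => Du'; apply/andP; split; lra.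
(* A zero derivative makes [E v] and [E vl] equal, but these are [D v] and the smaller [c], as [D]
   vanishes at [vl]. *)
have [t _] := MVT vlv dE cE; rewrite mul0r /E.
by rewrite max_l ?(ltW cD)// /D Gvl mul0r max_r ?(ltW c0)// -/(D v); lra.
Unshelve. all: by end_near. Qed.

(** The end values are one-sided limits from the open interval, and limits are unique. *)
Lemma eq_closed_itv (a b : R) (f g : R -> R) : a < b ->
  {within `[a, b], continuous f} -> {within `[a, b], continuous g} ->
  {in `]a, b[, f =1 g} -> {in `[a, b], f =1 g}.
Proof.
move=> ab cf cg fg.
have [_ fa fb] := (continuous_within_itvP _ ab).1 cf.
have [_ ga gb] := (continuous_within_itvP _ ab).1 cg.
move=> u; rewrite in_itv/= => /andP[].
rewrite le_eqVlt => /predU1P[<- _|au].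
  have fga : f x @[x --> a^'+] --> g a.
    apply: cvg_trans ga; apply: near_eq_cvg; near=> x.
    apply/esym/fg; rewrite in_itv/=; apply/andP; split; near: x.
      exact: nbhs_right_gt.
    exact: nbhs_right_lt.
  exact: cvg_unique fa fga.
rewrite le_eqVlt => /predU1P[->|ub]; last by apply: fg; rewrite in_itv/= au.
have fgb : f x @[x --> b^'-] --> g b.
  apply: cvg_trans gb; apply: near_eq_cvg; near=> x.
  apply/esym/fg; rewrite in_itv/=; apply/andP; split; near: x.
    exact: nbhs_left_gt.
  exact: nbhs_left_lt.
exact: cvg_unique fb fgb.
Unshelve. all: by end_near. Qed.

End DiagonalPlan.

(** * Diagonal plans and the first-price auction *)

Lemma eq_plan_payoff {R : realType} {n : nat} (P : probability (n.-tuple R) R)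
    (vl vh q : R) (s1 s2 t1 t2 : 'I_n -> R -> R) i v b1 b2 :
  (forall j, {in `[vl, vh], s1 j =1 t1 j}) ->
  (forall j, {in `[vl, vh], s2 j =1 t2 j}) ->
  plan_payoff P vl vh q s1 s2 i v b1 b2 = plan_payoff P vl vh q t1 t2 i v b1 b2.
Proof.
move=> st1 st2; apply: eq_Rintegral => w /set_mem Dw.
have E (s t : 'I_n -> R -> R) b : (forall j, {in `[vl, vh], s j =1 t j}) ->
    override (bids s w) i b = override (bids t w) i b.
  by move=> st; apply/funext => j; rewrite /override /bids st//; exact: Dw.
by rewrite (E _ _ _ st1) (E _ _ _ st2).
Qed.

Lemma plan_payoff_diagonal {R : realType} {n : nat}
    (P : probability (n.-tuple R) R) (vl vh q : R) (x : R -> R) i v b :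
  plan_payoff P vl vh q (fun=> x) (fun=> x) i v b b =
  fpa_interim P vl vh x i v b.
Proof.
by apply: eq_Rintegral => w _; rewrite /pbs_payoff -mulrDl addrC subrK mul1r.
Qed.

Theorem proposition2 (R : realType) (n : nat) (n_gt0 : (0 < n)%N)
    (mu : probability R R) (F : R -> R) (vl vh : R)
    (prior_mu : marginal_prior mu F vl vh)
    (P : probability (n.-tuple R) R)
    (prior_P : product_prior mu P)
    (q1 : R) (q1_01 : 0 < q1 < 1)
    (beta : R -> R) (fpa_beta : unique_fpa_equilibrium mu P vl vh beta)
    (a : assessment R n) (x z : R -> R)
    (pbe_a : perfect_bayesian_equilibrium mu P vl vh q1 a)
    (reg_a : regular_pure mu P vl vh q1 F a x z) :
  {ae mu, forall v, v \in `[vl, vh] -> x v = z v /\ z v = beta v} /\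
  payoff_equivalent_to_fpa P vl vh q1 a beta.
Proof.
have vlvh := vl_lt_vh prior_mu.
have [_ plan_xz order_xz [cx cz] [x_nd z_nd] _ [lx lz] br_xz] := reg_a.
have mx : measurable_fun [set` `[vl, vh]] x.
  exact: subspace_continuous_measurable_fun.
have mz : measurable_fun [set` `[vl, vh]] z.
  exact: subspace_continuous_measurable_fun.
have x_incr := cdf_law_increasing prior_mu lx x_nd.
have z_incr := cdf_law_increasing prior_mu lz z_nd.
pose G v := F v ^+ n.-1.
have IC : {in `[vl, vh] & &, forall v w w', x w <= z w' ->
    q1 * (G w * (v - x w)) + (1 - q1) * (G w' * (v - z w')) <=
    q1 * (G v * (v - x v)) + (1 - q1) * (G v * (v - z v))}.
  (* The deviation [(x w, z w')] wins with chances [G w] and [G w']; by symmetry the constraints of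
     one builder suffice. *)
  move=> v w w' vI wI w'I xw_zw'; have [xw0 _ _] := order_xz w wI.
  have := br_xz (Ordinal n_gt0) v vI _ _ xw0 xw_zw'.
  by rewrite !plan_payoffE// !(win_chanceE prior_mu prior_P).
have [vlI vhI] : vl \in `[vl, vh] /\ vh \in `[vl, vh].
  by rewrite !in_itv/= !lexx !ltW.
have n_gt1 : (0 < n.-1)%N.
  (* A lone bidder always wins and so would imitate the lowest type. *)
  rewrite lt0n; apply/eqP => n1.
  have [_ xz _] := order_xz vl vlI.
  have := IC vh vl vl vhI vlI vlI xz; rewrite /G n1 !expr0 !mul1r.
  have := x_incr _ _ vlI vhI vlvh; have := z_incr _ _ vlI vhI vlvh.
  case/andP: q1_01 => q0 q1' zz xx; nra.
have xz : {in `[vl, vh], x =1 z}.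
  apply: (eq_closed_itv vlvh cx cz).
  apply: (incentive_compatible_diagonal q1_01 (G := G)) => //.
  (* [0 ^+ n.-1] would be 1 for a single builder, a case excluded by [n_gt1]. *)
  - by rewrite /G (cdf_vl prior_mu) expr0n gtn_eqF.
  - by move=> v vI; rewrite exprn_gt0// (cdf_gt0 prior_mu).
  - by move=> v vI; exact/within_continuousX/(cdf_continuous prior_mu).
  - by move=> v /order_xz[].
have payoff_xz i v b :
    plan_payoff P vl vh q1 (fun=> x) (fun=> z) i v b b =
    fpa_interim P vl vh x i v b.
  rewrite -(plan_payoff_diagonal _ _ _ q1); apply: eq_plan_payoff => // j v' v'I.
  by rewrite xz.
have eq_x : fpa_equilibrium P vl vh x.
  split=> // [v /order_xz[]//|i v vI b b0].
  (* The plan [(b, b)] is feasible for every [b >= 0], so full-plan optimality covers every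
     deviation in the one-shot auction. *)
  rewrite -!payoff_xz {2}xz//; exact: br_xz.
have [[mbeta beta0 br_beta] beta_uniq] := fpa_beta.
have x_beta := beta_uniq x eq_x.
have s1x j : {in `[vl, vh], stage1 a j =1 x} by move=> v /(plan_xz j)[].
have s2z j : {in `[vl, vh], onpath2 a j =1 z}.
  by move=> v vI; rewrite /onpath2; have [-> ->] := plan_xz j v vI.
split.
  apply: filterS x_beta => v xb vI; rewrite -xz//; split=> //; exact: xb.
move=> i; split=> [v vI|].
  rewrite /pbs_interim s1x// s2z// -xz//.
  transitivity (plan_payoff P vl vh q1 (fun=> x) (fun=> z) i v (x v) (x v)).
    exact: eq_plan_payoff.
  rewrite payoff_xz; have [x0 _ _] := order_xz v vI.
  (* [x] and [beta] need not agree at [v], but both bids are best responses to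
     bid functions that agree almost everywhere. *)
  have interimE b := ae_eq_interim prior_P i v b mx mbeta x_beta.
  have [_ _ br_x] := eq_x.
  apply: le_anti; rewrite {1}interimE br_beta//= -interimE.
  by apply: br_x => //; exact: beta0.
rewrite -(ae_eq_exante prior_P i mx mbeta x_beta).
(* At every value profile both stages carry the bids of [x], so the weights [q1] and [1 - q1] add up
   to 1 on the same payoff. *)
apply: eq_Rintegral => w /set_mem Dw.
have -> : bids (stage1 a) w = bids (fun=> x) w.
  by apply/funext => j; rewrite /bids s1x//; exact: Dw.
have -> : bids (onpath2 a) w = bids (fun=> x) w.
  by apply/funext => j; rewrite /bids s2z ?xz//; exact: Dw.
by rewrite /pbs_payoff -mulrDl addrC subrK mul1r.
Qed.
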